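(* Let $\mathbf{k}$ be a commutative unital ring, $\lambda\in\mathbf{k}$, let $(A,\mu,1,r)$ be a quasitriangular infinitesimal unitary bialgebra of weight $\lambda$ with $r=\sum_i u_i\otimes v_i\in A\otimes A$, and let $M$ be a left $A$-module. Then $M$, with its given $A$-module structure and the map $\Lambda:M\to A\otimes M$ given by $$\Lambda(m):=-\sum_i u_i\otimes v_i m\quad\text{for } m\in M,$$ is a left infinitesimal unitary Hopf module of weight $\lambda$ over $A$ (where $A$ is regarded as the infinitesimal unitary bialgebra $(A,\mu,1,\Delta_r)$ of weight $\lambda$).
   Context: All modules, tensor products and linear maps are over $\mathbf{k}$. A coalgebra is coassociative, possibly without counit; likewise a left comodule is only required to be coassociative. For an algebra $A$, $A\otimes A$ is an $A$-bimodule via $a\cdot(b\otimes c)=ab\otimes c$, $(b\otimes c)\cdot a=b\otimes ca$. An infinitesimal unitary bialgebra of weight $\lambda$ is a quadruple $(A,\mu,1,\Delta)$ with $(A,\mu,1)$ a unital associative algebra and $(A,\Delta)$ a coalgebra such that $\Delta(ab)=a\cdot\Delta(b)+\Delta(a)\cdot b+\lambda(a\otimes b)$ for all $a,b\in A$. A quasitriangular infinitesimal unitary bialgebra of weight $\lambda$ is a quadruple $(A,\mu,1,r)$ consisting of a unital associative algebra $(A,\mu,1)$ and an element $r=\sum_i u_i\otimes v_i\in A\otimes A$ that solves the associative Yang–Baxter equation of weight $\lambda$: $$r_{13}r_{12}-r_{12}r_{23}+r_{23}r_{13}=\lambda r_{13}\quad\text{in }A\otimes A\otimes A,$$ where $r_{12}=\sum_i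 u_i\otimes v_i\otimes 1$, $r_{13}=\sum_i u_i\otimes 1\otimes v_i$, $r_{23}=\sum_i 1\otimes u_i\otimes v_i$. In this case $\Delta_r(a):=a\cdot r-r\cdot a-\lambda(a\otimes 1)$ makes $(A,\mu,1,\Delta_r)$ an infinitesimal unitary bialgebra of weight $\lambda$ (known fact). A left infinitesimal unitary Hopf module of weight $\lambda$ over an infinitesimal unitary bialgebra $(A,\mu,1,\Delta)$ of weight $\lambda$ is a $\mathbf{k}$-module $M$ with a left $A$-module structure $a\otimes m\mapsto am$ and a left $A$-comodule structure $\Lambda:M\to A\otimes M$ (i.e. $(\mathrm{id}_A\otimes\Lambda)\Lambda=(\Delta\otimes\mathrm{id}_M)\Lambda$) such that for all $a\in A$, $m\in M$, $$\Lambda(am)=a\Lambda(m)+\Delta(a)m+\lambda(a\otimes m),$$ where $a(b\otimes m)=ab\otimes m$ and $(b\otimes c)m=b\otimes cm$. *)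

(* Defs.v *)
From HB Require Import structures.
From mathcomp Require Import all_boot all_algebra.
From mathcomp Require Import boolp.

Set Implicit Arguments.
Unset Strict Implicit.
Unset Printing Implicit Defensive.

Import GRing.Theory.
Local Open Scope ring_scope.
Local Open Scope quotient_scope.

Reserved Notation "M ⊗ N" (at level 40, left associativity).

(* Unital associative k-algebras. The library's [algType] is nontrivial by      *)
(* definition; here 1 = 0 is allowed, as is the zero ring for k. Multiplication *)
(* is part of the mixin because the library already fixes its own joins of      *)
(* modules and rings below [algType]; the ring structure is the instance that   *)
(* follows, so that a * b and 1 have their usual meaning.                       *)
HB.mixin Record isPzAlgebra (k : comPzRingType) A of GRing.Lmodule k A := {
  pzone : A;
  pzmul : A -> A -> A;
  pzmulA : associative pzmul;
  pzmul1r : left_id pzone pzmul;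
  pzmulr1 : right_id pzone pzmul;
  pzmulDl : left_distributive pzmul +%R;
  pzmulDr : right_distributive pzmul +%R;
  pzmulZl : forall (c : k) (a b : A), c *: pzmul a b = pzmul (c *: a) b;
  pzmulZr : forall (c : k) (a b : A), c *: pzmul a b = pzmul a (c *: b)
}.

#[short(type="pzAlgType")]
HB.structure Definition PzAlgebra (k : comPzRingType) :=
  {A of isPzAlgebra k A & GRing.Lmodule k A}.

#[non_forgetful_inheritance]
HB.instance Definition _ (k : comPzRingType) (A : pzAlgType k) :=
  GRing.Zmodule_isPzRing.Build A (@pzmulA k A) (@pzmul1r k A) (@pzmulr1 k A)
    (@pzmulDl k A) (@pzmulDr k A).

#[non_forgetful_inheritance]
HB.instance Definition _ (k : comPzRingType) (A : algType k) :=
  isPzAlgebra.Build k A (@mulrA A) (@mul1r A) (@mulr1 A) (@mulrDl A)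
    (@mulrDr A) (fun c a b => scalerAl c a b) (fun c a b => scalerAr c a b).

Section PzAlgebraTheory.
Variables (k : comPzRingType) (A : pzAlgType k).
Implicit Types (c : k) (a b : A).

Lemma pzscalerAl c a b : c *: (a * b) = (c *: a) * b.
Proof. exact: pzmulZl. Qed.

Lemma pzscalerAr c a b : c *: (a * b) = a * (c *: b).
Proof. exact: pzmulZr. Qed.

End PzAlgebraTheory.

Section Bilinear.
Variables (k : comPzRingType) (M N V : lmodType k).

Definition bilinear_map (h : M -> N -> V) : Prop :=
  (forall y, linear (h^~ y)) /\ (forall x, linear (h x)).

Variable (h : M -> N -> V).
Hypothesis hB : bilinear_map h.

Lemma bilinDl x x' y : h (x + x') y = h x y + h x' y.
Proof. by have := hB.1 y 1 x x'; rewrite !scale1r. Qed.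
Lemma bilinDr x y y' : h x (y + y') = h x y + h x y'.
Proof. by have := hB.2 x 1 y y'; rewrite !scale1r. Qed.
Lemma bilin0l y : h 0 y = 0.
Proof. by apply: (addIr (h 0 y)); rewrite -bilinDl !add0r. Qed.
Lemma bilin0r x : h x 0 = 0.
Proof. by apply: (addIr (h x 0)); rewrite -bilinDr !add0r. Qed.
Lemma bilinZl c x y : h (c *: x) y = c *: h x y.
Proof. by have := hB.1 y c x 0; rewrite !addr0 bilin0l addr0. Qed.
Lemma bilinZr c x y : h x (c *: y) = c *: h x y.
Proof. by have := hB.2 x c y 0; rewrite !addr0 bilin0r addr0. Qed.

End Bilinear.

Section LinearMaps.
Variables (k : comPzRingType) (M N : lmodType k) (f : M -> N).
Hypothesis fL : linear f.

Lemma linD x y : f (x + y) = f x + f y.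
Proof. by have := fL 1 x y; rewrite !scale1r. Qed.
Lemma lin0 : f 0 = 0.
Proof. by apply: (addIr (f 0)); rewrite -linD !add0r. Qed.
Lemma linZ c x : f (c *: x) = c *: f x.
Proof. by have := fL c x 0; rewrite !addr0 lin0 addr0. Qed.
Lemma lin_sum I (s : seq I) (F : I -> M) :
  f (\sum_(i <- s) F i) = \sum_(i <- s) f (F i).
Proof.
by elim: s => [|i s IH]; rewrite ?big_nil ?lin0 // !big_cons linD IH.
Qed.
End LinearMaps.

Section Tensor.
Variables (k : comPzRingType) (M N : lmodType k).

(* A sequence [:: (x1, y1); ...; (xn, yn)] stands for the sum of the xi ⊗ yi;   *)
(* concatenation stands for addition. Sequences only form a monoid, so that     *)
(* 0 ⊗ y = 0 has to be imposed along with the bilinearity relations; opposites  *)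
(* are then provided by - (x ⊗ y) = (- x) ⊗ y.                                  *)
Inductive tens_rel : seq (M * N) -> seq (M * N) -> Prop :=
| TensRefl s : tens_rel s s
| TensSym s t : tens_rel s t -> tens_rel t s
| TensTrans t s u : tens_rel s t -> tens_rel t u -> tens_rel s u
| TensCat s s' t t' : tens_rel s s' -> tens_rel t t' ->
    tens_rel (s ++ t) (s' ++ t')
| TensCatC s t : tens_rel (s ++ t) (t ++ s)
| Tens0 y : tens_rel [:: (0, y)] [::]
| TensDl x x' y : tens_rel [:: (x + x', y)] [:: (x, y); (x', y)]
| TensDr x y y' : tens_rel [:: (x, y + y')] [:: (x, y); (x, y')]
| TensZ c x y : tens_rel [:: (c *: x, y)] [:: (x, c *: y)].

Definition tens_relb s t := `[< tens_rel s t >].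

Lemma tens_relb_equiv : equiv_class_of tens_relb.
Proof.
split=> [s|s t|t s u].
- exact/asboolP/TensRefl.
- by apply/asboolP/asboolP; apply: TensSym.
- by move=> /asboolP st /asboolP tu; apply/asboolP/(TensTrans st tu).
Qed.

Canonical tens_equiv := EquivRelPack tens_relb_equiv.

Definition tensor := {eq_quot tens_equiv}.
HB.instance Definition _ := Choice.on tensor.

Definition tens_class (s : seq (M * N)) : tensor := \pi_tensor s.

Lemma tens_classP s t : tens_rel s t <-> tens_class s = tens_class t.
Proof.
split=> [st|/eqP]; first by apply/eqmodP/asboolP.
by rewrite /tens_class eqmodE => /asboolP.
Qed.

Lemma tens_reprK (t : tensor) : tens_class (repr t) = t.
Proof. exact: reprK. Qed.

Lemma repr_tens_class s : tens_rel (repr (tens_class s)) s.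
Proof. by apply/tens_classP; rewrite tens_reprK. Qed.

Definition tens_add (s t : tensor) := tens_class (repr s ++ repr t).
Definition tens_opp (s : tensor) := tens_class [seq (- p.1, p.2) | p <- repr s].
Definition tens_scale (c : k) (s : tensor) :=
  tens_class [seq (c *: p.1, p.2) | p <- repr s].

Lemma tens_addE s t : tens_add (tens_class s) (tens_class t) = tens_class (s ++ t).
Proof. by apply/tens_classP; apply: TensCat; exact: repr_tens_class. Qed.

Lemma tens_map (f : M -> M) s t : linear f -> tens_rel s t ->
  tens_rel [seq (f p.1, p.2) | p <- s] [seq (f p.1, p.2) | p <- t].
Proof.
move=> fL; elim=> {s t} /=.
- by move=> s; exact: TensRefl.
- by move=> s t _; exact: TensSym.
- by move=> t s u _ st _ tu; exact: TensTrans st tu.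
- by move=> s s' t t' _ ? _ ?; rewrite !map_cat; exact: TensCat.
- by move=> s t; rewrite !map_cat; exact: TensCatC.
- by move=> y; rewrite (lin0 fL); exact: Tens0.
- by move=> x x' y; rewrite (linD fL); exact: TensDl.
- by move=> x y y'; exact: TensDr.
- by move=> c x y; rewrite (linZ fL); exact: TensZ.
Qed.

Lemma opp_linear : linear (fun x : M => - x).
Proof. by move=> c x y /=; rewrite opprD scalerN. Qed.

Lemma scale_linear (c : k) : linear (fun x : M => c *: x).
Proof. by move=> d x y /=; rewrite scalerDr !scalerA mulrC. Qed.

Lemma tens_oppE s : tens_opp (tens_class s) = tens_class [seq (- p.1, p.2) | p <- s].
Proof. by apply/tens_classP; apply: tens_map opp_linear _; exact: repr_tens_class. Qed.

Lemma tens_scaleE c s :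
  tens_scale c (tens_class s) = tens_class [seq (c *: p.1, p.2) | p <- s].
Proof. by apply/tens_classP; apply: tens_map (scale_linear c) _; exact: repr_tens_class. Qed.

Lemma tens_class_ind (P : tensor -> Prop) : (forall s, P (tens_class s)) -> forall t, P t.
Proof. by move=> Ps t; rewrite -(tens_reprK t). Qed.

Lemma tens_addA : associative tens_add.
Proof.
elim/tens_class_ind=> s; elim/tens_class_ind=> t; elim/tens_class_ind=> u.
by rewrite !tens_addE catA.
Qed.

Lemma tens_addC : commutative tens_add.
Proof.
elim/tens_class_ind=> s; elim/tens_class_ind=> t; rewrite !tens_addE.
by apply/tens_classP; exact: TensCatC.
Qed.

Lemma tens_add0 : left_id (tens_class [::]) tens_add.
Proof. by elim/tens_class_ind=> s; rewrite tens_addE. Qed.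

Lemma tens_addN : left_inverse (tens_class [::]) tens_opp tens_add.
Proof.
elim/tens_class_ind; elim=> [|[x y] s IH]; first by rewrite tens_oppE tens_addE.
rewrite -cat1s -tens_addE.
have -> : tens_opp (tens_add (tens_class [:: (x, y)]) (tens_class s)) =
  tens_add (tens_opp (tens_class s)) (tens_class [:: (- x, y)]).
  by rewrite tens_addC tens_addE !tens_oppE tens_addE map_cat.
rewrite tens_addA -(tens_addA _ (tens_class [:: (- x, y)])) (tens_addE [:: _]) /=.
have -> : tens_class [:: (- x, y); (x, y)] = tens_class [::].
  apply/tens_classP; apply: (@TensTrans [:: (- x + x, y)]).
    exact/TensSym/TensDl.
  by rewrite addNr; exact: Tens0.
by rewrite (tens_addC _ (tens_class [::])) tens_add0.
Qed.

HB.instance Definition _ :=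
  GRing.isZmodule.Build tensor tens_addA tens_addC tens_add0 tens_addN.

Lemma tens_scaleA a b v : tens_scale a (tens_scale b v) = tens_scale (a * b) v.
Proof.
elim/tens_class_ind: v => s; rewrite !tens_scaleE -map_comp.
by congr tens_class; apply: eq_map => p /=; rewrite scalerA.
Qed.

Lemma tens_scale1 : left_id 1 tens_scale.
Proof.
elim/tens_class_ind => s; rewrite !tens_scaleE.
by congr tens_class; rewrite -[RHS]map_id; apply: eq_map => -[x y] /=; rewrite scale1r.
Qed.

Lemma tens_scaleDr : right_distributive tens_scale +%R.
Proof.
move=> c; elim/tens_class_ind => s; elim/tens_class_ind => t.
change (tens_scale c (tens_add (tens_class s) (tens_class t)) =
  tens_add (tens_scale c (tens_class s)) (tens_scale c (tens_class t))).
by rewrite !(tens_addE, tens_scaleE) map_cat.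
Qed.

Lemma tens_scaleDl v : {morph tens_scale^~ v : a b / a + b}.
Proof.
move=> a b /=; elim/tens_class_ind: v.
elim=> [|[x y] s IH]; first by rewrite !tens_scaleE /= [RHS]tens_addE.
rewrite -cat1s -tens_addE.
change (tens_add ?s ?t) with (s + t).
rewrite !tens_scaleDr IH addrACA; congr (_ + _).
rewrite !tens_scaleE /= [RHS]tens_addE /= scalerDl.
by apply/tens_classP; exact: TensDl.
Qed.

HB.instance Definition _ := GRing.Zmodule_isLmodule.Build k tensor
  tens_scaleA tens_scale1 tens_scaleDr tens_scaleDl.

Definition tens (x : M) (y : N) : tensor := tens_class [:: (x, y)].

End Tensor.

Arguments tensor {k} (M N)%_type.
Notation "M ⊗ N" := (tensor M N) : type_scope.
Notation "x ⊗ y" := (tens x y) : ring_scope.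

Section TensorTheory.
Variables (k : comPzRingType) (M N : lmodType k).
Implicit Types (x : M) (y : N) (t : M ⊗ N).

Lemma tens_class_cat (s s' : seq (M * N)) :
  tens_class (s ++ s') = tens_class s + tens_class s'.
Proof. by rewrite -[LHS]tens_addE. Qed.

Lemma tensDl x x' y : (x + x') ⊗ y = x ⊗ y + x' ⊗ y.
Proof. by rewrite -tens_class_cat; apply/tens_classP; exact: TensDl. Qed.

Lemma tensDr x y y' : x ⊗ (y + y') = x ⊗ y + x ⊗ y'.
Proof. by rewrite -tens_class_cat; apply/tens_classP; exact: TensDr. Qed.

Lemma tensZl c x y : (c *: x) ⊗ y = c *: (x ⊗ y).
Proof. by rewrite -[RHS]/(tens_scale _ _) tens_scaleE. Qed.

Lemma tensZr c x y : x ⊗ (c *: y) = c *: (x ⊗ y).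
Proof. by rewrite -tensZl; apply/tens_classP; exact/TensSym/TensZ. Qed.

Lemma tens_bilinear : bilinear_map (@tens k M N).
Proof.
by split=> [y c x x'|x c y y'] /=; rewrite ?tensDl ?tensDr ?tensZl ?tensZr.
Qed.

Lemma tens_classE (s : seq (M * N)) : tens_class s = \sum_(p <- s) p.1 ⊗ p.2.
Proof.
elim: s => [|[x y] s IH]; first by rewrite big_nil.
by rewrite big_cons -IH /= -tens_class_cat.
Qed.

Lemma tens_span t : exists n (u : 'I_n -> M) (v : 'I_n -> N), t = \sum_i u i ⊗ v i.
Proof.
pose s := repr t; exists (size s), (fun i => (tnth (in_tuple s) i).1),
  (fun i => (tnth (in_tuple s) i).2).
by rewrite -[LHS]tens_reprK tens_classE big_tnth.
Qed.

Lemma tens_ind (P : M ⊗ N -> Prop) : (forall x y, P (x ⊗ y)) -> P 0 ->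
  (forall s t, P s -> P t -> P (s + t)) -> forall t, P t.
Proof.
move=> Pt P0 PD t; have [n [u [v ->]]] := tens_span t.
exact: (big_ind P).
Qed.

Variable V : lmodType k.

(* The linear map induced by h; meaningful (independent of the representative)  *)
(* when h is bilinear, see [tliftE] and [tlift_uniq].                           *)
Definition tlift (h : M -> N -> V) (t : M ⊗ N) : V :=
  \sum_(p <- repr t) h p.1 p.2.

Section Lift.
Variable h : M -> N -> V.
Hypothesis hB : bilinear_map h.

Lemma tlift_rel s s' : tens_rel s s' ->
  \sum_(p <- s) h p.1 p.2 = \sum_(p <- s') h p.1 p.2.
Proof.
elim=> {s s'} //=.
- by move=> t s u _ -> _ ->.
- by move=> s s' t t' _ IH _ IH'; rewrite !big_cat /= IH IH'.
- by move=> s t; rewrite !big_cat /= addrC.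
- by move=> y; rewrite !big_cons !big_nil /= (bilin0l hB) addr0.
- by move=> x x' y; rewrite !big_cons !big_nil /= !addr0 (bilinDl hB).
- by move=> x y y'; rewrite !big_cons !big_nil /= !addr0 (bilinDr hB).
- by move=> c x y; rewrite !big_cons !big_nil /= !addr0 (bilinZl hB) (bilinZr hB).
Qed.

Lemma tlift_class s : tlift h (tens_class s) = \sum_(p <- s) h p.1 p.2.
Proof. exact/tlift_rel/repr_tens_class. Qed.

Lemma tliftE x y : tlift h (x ⊗ y) = h x y.
Proof. by rewrite tlift_class big_cons big_nil addr0. Qed.

Lemma tlift_linear : linear (tlift h).
Proof.
move=> c; elim/tens_class_ind=> s; elim/tens_class_ind=> t.
have -> : c *: tens_class s = tens_class [seq (c *: p.1, p.2) | p <- s].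
  by rewrite -[LHS]/(tens_scale _ _) tens_scaleE.
rewrite -tens_class_cat !tlift_class big_cat big_map scaler_sumr /=.
by congr (_ + _); apply: eq_bigr => p _; rewrite (bilinZl hB).
Qed.

Lemma tlift_uniq (f : M ⊗ N -> V) :
  linear f -> (forall x y, f (x ⊗ y) = h x y) -> f =1 tlift h.
Proof.
move=> fL fE; apply: tens_ind => [x y||s t Hs Ht].
- by rewrite fE tliftE.
- by rewrite (lin0 fL) (lin0 tlift_linear).
- by rewrite (linD fL) (linD tlift_linear) Hs Ht.
Qed.

End Lift.
End TensorTheory.

Section TensorMap.
Variables (k : comPzRingType) (M M' N N' : lmodType k).

(* f ⊗ g, for f and g linear. *)
Definition tmap (f : M -> M') (g : N -> N') : M ⊗ N -> M' ⊗ N' :=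
  tlift (fun x y => f x ⊗ g y).

Section Props.
Variables (f : M -> M') (g : N -> N').
Hypotheses (fL : linear f) (gL : linear g).

Lemma tmap_bilinear : bilinear_map (fun x y => f x ⊗ g y).
Proof.
by split=> [y c x x'|x c y y'] /=; rewrite ?fL ?gL ?tensDl ?tensDr ?tensZl ?tensZr.
Qed.

Lemma tmapE x y : tmap f g (x ⊗ y) = f x ⊗ g y.
Proof. exact: (tliftE tmap_bilinear). Qed.

Lemma tmap_linear : linear (tmap f g).
Proof. exact: (tlift_linear tmap_bilinear). Qed.

End Props.
End TensorMap.

Section Associator.
Variables (k : comPzRingType) (M N P : lmodType k).

Definition tassoc : (M ⊗ N) ⊗ P -> M ⊗ (N ⊗ P) :=
  tlift (fun t z => tlift (fun x y => x ⊗ (y ⊗ z)) t).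

Lemma tassoc_bil1 z : bilinear_map (fun (x : M) (y : N) => x ⊗ (y ⊗ z : N ⊗ P)).
Proof.
by split=> [y c x x'|x c y y'] /=; rewrite !(tensDl, tensDr) ?(tensZl, tensZr).
Qed.

Lemma tassoc_bil2 : bilinear_map (fun (t : M ⊗ N) (z : P) =>
  tlift (fun x y => x ⊗ (y ⊗ z : N ⊗ P)) t).
Proof.
split=> [z|t c z z'] /=; first exact: (tlift_linear (tassoc_bil1 z)).
elim/tens_ind: t => [x y||s t Hs Ht].
- rewrite !(tliftE (tassoc_bil1 _)).
  by rewrite !(tensDl, tensDr) ?(tensZl, tensZr).
- by rewrite !(lin0 (tlift_linear (tassoc_bil1 _))) scaler0 addr0.
- by rewrite !(linD (tlift_linear (tassoc_bil1 _))) Hs Ht scalerDr addrACA.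
Qed.

Lemma tassocE x y z : tassoc ((x ⊗ y) ⊗ z) = x ⊗ (y ⊗ z).
Proof. by rewrite /tassoc (tliftE tassoc_bil2) (tliftE (tassoc_bil1 _)). Qed.

Lemma tassoc_linear : linear tassoc.
Proof. exact: tlift_linear tassoc_bil2. Qed.

End Associator.

Section TensorAlgebra.
Variables (k : comPzRingType) (A B : pzAlgType k).

Definition tens_mul (s t : A ⊗ B) : A ⊗ B :=
  tlift (fun (a : A) (b : B) => tlift (fun (a' : A) (b' : B) => (a * a') ⊗ (b * b')) t) s.

Lemma mull_linear (C : pzAlgType k) (a : C) : linear (fun x : C => a * x).
Proof. by move=> c x y /=; rewrite mulrDr pzscalerAr. Qed.

Lemma mulr_linear (C : pzAlgType k) (a : C) : linear (fun x : C => x * a).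
Proof. by move=> c x y /=; rewrite mulrDl pzscalerAl. Qed.

Let bil1 (a : A) (b : B) : bilinear_map (fun (a' : A) (b' : B) => (a * a') ⊗ (b * b')).
Proof. exact: (tmap_bilinear (mull_linear a) (mull_linear b)). Qed.

Let bil2 (t : A ⊗ B) : bilinear_map
  (fun (a : A) (b : B) => tlift (fun (a' : A) (b' : B) => (a * a') ⊗ (b * b')) t).
Proof.
split=> [b c a a'|a c b b'] /=; elim/tens_ind: t => [x y||s t Hs Ht];
  rewrite ?(tliftE (bil1 _ _)) ?(lin0 (tlift_linear (bil1 _ _)))
    ?(linD (tlift_linear (bil1 _ _))) ?Hs ?Ht ?scalerDr ?scaler0 ?addr0
    1?addrACA //.
- by rewrite mulrDl -pzscalerAl tensDl tensZl.
- by rewrite mulrDl -pzscalerAl tensDr tensZr.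
Qed.

Lemma tens_mulE a b a' b' : tens_mul (a ⊗ b) (a' ⊗ b') = (a * a') ⊗ (b * b').
Proof. by rewrite /tens_mul (tliftE (bil2 _)) (tliftE (bil1 _ _)). Qed.

Lemma tens_mul_bilinear : bilinear_map tens_mul.
Proof.
split=> [t|s c t t']; first exact: (tlift_linear (bil2 t)).
elim/tens_ind: s => [x y||s s' Hs Hs'].
- by rewrite /tens_mul !(tliftE (bil2 _)) (tlift_linear (bil1 _ _)).
- by rewrite /tens_mul !(lin0 (tlift_linear (bil2 _))) scaler0 addr0.
- rewrite /tens_mul !(linD (tlift_linear (bil2 _))) -!/(tens_mul _ _) Hs Hs'.
  by rewrite scalerDr addrACA.
Qed.

Let mulDl := bilinDl tens_mul_bilinear.
Let mulDr := bilinDr tens_mul_bilinear.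
Let mul0l := bilin0l tens_mul_bilinear.
Let mul0r := bilin0r tens_mul_bilinear.

Lemma tens_mulA : associative tens_mul.
Proof.
elim/tens_ind=> [a b||s s' Hs Hs'] t u; last 2 first.
- by rewrite !mul0l.
- by rewrite !mulDl Hs Hs'.
elim/tens_ind: t => [a' b'||s s' Hs Hs']; last 2 first.
- by rewrite !(mul0l, mul0r).
- by rewrite !(mulDl, mulDr) Hs Hs'.
elim/tens_ind: u => [a'' b''||s s' Hs Hs']; last 2 first.
- by rewrite !(mul0l, mul0r).
- by rewrite !mulDr Hs Hs'.
by rewrite !tens_mulE !mulrA.
Qed.

Lemma tens_mul1l : left_id ((1 : A) ⊗ (1 : B)) tens_mul.
Proof.
elim/tens_ind=> [a b||s t Hs Ht]; first by rewrite tens_mulE !mul1r.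
  by rewrite mul0r.
by rewrite mulDr Hs Ht.
Qed.

Lemma tens_mul1r : right_id ((1 : A) ⊗ (1 : B)) tens_mul.
Proof.
elim/tens_ind=> [a b||s t Hs Ht]; first by rewrite tens_mulE !mulr1.
  by rewrite mul0l.
by rewrite mulDl Hs Ht.
Qed.

Lemma tens_scaleAl (c : k) (s t : A ⊗ B) : c *: tens_mul s t = tens_mul (c *: s) t.
Proof. by rewrite (bilinZl tens_mul_bilinear). Qed.

Lemma tens_scaleAr (c : k) (s t : A ⊗ B) : c *: tens_mul s t = tens_mul s (c *: t).
Proof. by rewrite (bilinZr tens_mul_bilinear). Qed.

HB.instance Definition _ := isPzAlgebra.Build k (tensor A B)
  tens_mulA tens_mul1l tens_mul1r (fun s t u => mulDl s t u)
  (fun s t u => mulDr s t u) tens_scaleAl tens_scaleAr.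
HB.instance Definition _ := GRing.PzRing.copy (tensor A B) (tensor A B : pzAlgType k).

Lemma mulr_tens (a a' : A) (b b' : B) : (a ⊗ b) * (a' ⊗ b') = (a * a') ⊗ (b * b').
Proof. exact: tens_mulE. Qed.

End TensorAlgebra.

HB.mixin Record hasLeftAction (k : comPzRingType) (A : pzAlgType k) M
    of GRing.Lmodule k M := {
  lact : A -> M -> M;
  lact_bilinear : bilinear_map lact;
  lact1 : forall m, lact 1 m = m;
  lactM : forall a b m, lact (a * b) m = lact a (lact b m)
}.

#[short(type="leftModType")]
HB.structure Definition LeftModule (k : comPzRingType) (A : pzAlgType k) :=
  {M of hasLeftAction k A M & GRing.Lmodule k M}.

Section HopfModules.
Variables (k : comPzRingType) (lam : k) (A : pzAlgType k).

(* a · (b ⊗ m) = ab ⊗ m *)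
Definition tens_lmul (M : lmodType k) (a : A) : A ⊗ M -> A ⊗ M :=
  tmap (fun b : A => a * b) id.

(* (b ⊗ c) · a = b ⊗ ca *)
Definition tens_rmul (t : A ⊗ A) (a : A) : A ⊗ A := tmap id (fun c : A => c * a) t.

(* (b ⊗ c) m = b ⊗ cm *)
Definition tens_act (M : leftModType A) (t : A ⊗ A) (m : M) : A ⊗ M :=
  tmap id (fun c : A => lact c m) t.

Definition coassociative (Delta : A -> A ⊗ A) : Prop :=
  forall a, tmap id Delta (Delta a) = tassoc (tmap Delta id (Delta a)).

Record inf_unitary_bialgebra (Delta : A -> A ⊗ A) : Prop := InfUnitaryBialgebra {
  bialg_linear : linear Delta;
  bialg_coassoc : coassociative Delta;
  bialg_compat : forall a b : A,
    Delta (a * b) =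
      tens_lmul a (Delta b) + tens_rmul (Delta a) b + lam *: (a ⊗ b)
}.

Record left_inf_unitary_hopf_module (Delta : A -> A ⊗ A) (M : leftModType A)
    (Lambda : M -> A ⊗ M) : Prop := LeftInfUnitaryHopfModule {
  hopf_bialgebra : inf_unitary_bialgebra Delta;
  hopf_linear : linear Lambda;
  hopf_coassoc : forall m,
    tmap id Lambda (Lambda m) = tassoc (tmap Delta id (Lambda m));
  hopf_compat : forall (a : A) (m : M),
    Lambda (lact a m) =
      tens_lmul a (Lambda m) + tens_act (Delta a) m + lam *: (a ⊗ m)
}.

Definition r12 (r : A ⊗ A) : A ⊗ (A ⊗ A) := tmap id (fun v : A => v ⊗ (1 : A)) r.
Definition r13 (r : A ⊗ A) : A ⊗ (A ⊗ A) := tmap id (fun v : A => (1 : A) ⊗ v) r.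
Definition r23 (r : A ⊗ A) : A ⊗ (A ⊗ A) := (1 : A) ⊗ r.

Definition quasitriangular (r : A ⊗ A) : Prop :=
  r13 r * r12 r - r12 r * r23 r + r23 r * r13 r = lam *: r13 r.

Definition Delta_of (r : A ⊗ A) (a : A) : A ⊗ A :=
  tens_lmul a r - tens_rmul r a - lam *: (a ⊗ (1 : A)).

End HopfModules.

(* Main.v *)
Require Import Defs.
From mathcomp Require Import all_boot all_algebra.
From mathcomp Require Import boolp.

(** Write [r12 t], [r13 t], [r23 t] for the three ways of placing [t : A ⊗ A] in
    the algebra [A ⊗ (A ⊗ A)], and [a1], [a2], [a3] for [a : A] placed in one
    leg. The actions of [A] on [A ⊗ A] are multiplications in the algebra
    [A ⊗ A], so that, with [D = Delta_of lam r],
      [D a = (a ⊗ 1) * r - r * (1 ⊗ a) - lam *: (a ⊗ 1)].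
    Checking on pure tensors gives, for every [t : A ⊗ A],
      [(id ⊗ D) t = r12 t * r23 r - r23 r * r13 t - lam *: r12 t] and
      [(D ⊗ id) t = r13 t * r12 r - r12 r * r23 t - lam *: r13 t]
    ([tmap_id_Delta_of] and [tassoc_Delta_of_id]). Both coassociativity
    conditions follow from these two formulas.

    For [t = r], the Yang-Baxter equation turns the second one into
    [(D ⊗ id) r = - r23 r * r13 r]. Now [Lambda m = - r m], where [r] acts on
    [m] through its second factor. Iterating [Lambda] gives
    [(r23 r * r13 r) m], while [(D ⊗ id) (Lambda m) = - ((D ⊗ id) r) m], since
    acting on [m] touches only the last factor; so both composites agree and
    [Lambda] is coassociative.

    For [t = D a], expand both formulas with [r12], [r13], [r23] multiplicative.
    As [a1] commutes with [r23 r] and [a3] with [r12 r], the difference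
    of the two sides is [E * a3 - a1 * E], where [E = 0] is the Yang-Baxter
    equation; so [D] is coassociative.

    In the compatibility condition of [D] at [a], [b], the two occurrences of
    [(a ⊗ 1) * r * (1 ⊗ b)] cancel, as do those of [lam *: (a ⊗ b)]. In that of
    [Lambda] at [a], [m], it is [((a ⊗ 1) * r) m] and [lam *: (a ⊗ m)] that
    cancel. *)

Set Implicit Arguments.
Unset Strict Implicit.

Import GRing.Theory.
Local Open Scope ring_scope.

(** * Linear maps and maps out of a tensor product *)

Section LinearCombinators.
Variable k : comPzRingType.

Lemma linear_comp (U V W : lmodType k) (f : V -> W) (g : U -> V) :
  linear f -> linear g -> linear (fun x => f (g x)).
Proof. by move=> fL gL c x y /=; rewrite gL fL. Qed.

Lemma linear_sub (U V : lmodType k) (f g : U -> V) :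
  linear f -> linear g -> linear (fun x => f x - g x).
Proof.
by move=> fL gL c x y /=; rewrite fL gL scalerBr opprD addrACA.
Qed.

Lemma linear_opp (U V : lmodType k) (f : U -> V) :
  linear f -> linear (fun x => - f x).
Proof. by move=> fL c x y /=; rewrite fL opprD scalerN. Qed.

Lemma linear_scale (U V : lmodType k) (d : k) (f : U -> V) :
  linear f -> linear (fun x => d *: f x).
Proof. exact: linear_comp (scale_linear d). Qed.

Lemma linear_id (U : lmodType k) : linear (@id U).
Proof. by []. Qed.

Lemma linB (U V : lmodType k) (f : U -> V) :
  linear f -> forall x y, f (x - y) = f x - f y.
Proof. by move=> fL x y; rewrite -scaleN1r (linD fL) (linZ fL) scaleN1r. Qed.

Lemma linN (U V : lmodType k) (f : U -> V) :
  linear f -> forall x, f (- x) = - f x.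
Proof. by move=> fL x; rewrite -scaleN1r (linZ fL) scaleN1r. Qed.

(** This reduces the identities below that are linear in a tensor variable to
    pure tensors, on which all the maps involved compute. *)
Lemma tens_ext (M N V : lmodType k) (f g : M ⊗ N -> V) :
  linear f -> linear g -> (forall x y, f (x ⊗ y) = g (x ⊗ y)) -> f =1 g.
Proof.
move=> fL gL fg; apply: tens_ind => [//||s t Hs Ht].
  by rewrite (lin0 fL) (lin0 gL).
by rewrite (linD fL) (linD gL) Hs Ht.
Qed.

Lemma tensl_linear (M N : lmodType k) (y : N) : linear (fun x : M => x ⊗ y).
Proof. exact: (tens_bilinear M N).1. Qed.

Lemma tensr_linear (M N : lmodType k) (x : M) : linear (fun y : N => x ⊗ y).
Proof. exact: (tens_bilinear M N).2. Qed.

End LinearCombinators.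

Lemma tens_mul_morph (k : comPzRingType) (A B C : pzAlgType k)
    (f : A ⊗ B -> C) : linear f ->
  (forall a b a' b', f ((a ⊗ b) * (a' ⊗ b')) = f (a ⊗ b) * f (a' ⊗ b')) ->
  forall s t, f (s * t) = f s * f t.
Proof.
move=> fL fM s t; move: s; apply: tens_ext => [||a b].
- exact: linear_comp fL (mulr_linear t).
- exact: linear_comp (mulr_linear (f t)) fL.
move: t; apply: tens_ext => [||a' b']; last exact: fM.
- exact: linear_comp fL (mull_linear (a ⊗ b)).
- exact: linear_comp (mull_linear (f (a ⊗ b))) fL.
Qed.

(** * The three embeddings of [A ⊗ A] into [A ⊗ (A ⊗ A)] *)

Section Legs.
Variables (k : comPzRingType) (A : pzAlgType k).

Lemma r12_linear : linear (@r12 k A).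
Proof. by apply: tmap_linear; [exact: linear_id|exact: tensl_linear]. Qed.
Lemma r13_linear : linear (@r13 k A).
Proof. by apply: tmap_linear; [exact: linear_id|exact: tensr_linear]. Qed.
Lemma r23_linear : linear (@r23 k A).
Proof. exact: tensr_linear. Qed.

Lemma r12E (x y : A) : r12 (x ⊗ y) = x ⊗ (y ⊗ (1 : A)).
Proof. by rewrite /r12 tmapE //; exact: tensl_linear. Qed.
Lemma r13E (x y : A) : r13 (x ⊗ y) = x ⊗ ((1 : A) ⊗ y).
Proof. by rewrite /r13 tmapE //; exact: tensr_linear. Qed.

Lemma r12M (s t : A ⊗ A) : r12 (s * t) = r12 s * r12 t.
Proof.
apply: tens_mul_morph => [|a b a' b']; first exact: r12_linear.
by rewrite mulr_tens !r12E !mulr_tens mulr1.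
Qed.

Lemma r13M (s t : A ⊗ A) : r13 (s * t) = r13 s * r13 t.
Proof.
apply: tens_mul_morph => [|a b a' b']; first exact: r13_linear.
by rewrite mulr_tens !r13E !mulr_tens mulr1.
Qed.

Lemma r23M (s t : A ⊗ A) : r23 (s * t) = r23 s * r23 t.
Proof. by rewrite /r23 mulr_tens mulr1. Qed.

(** Elements supported on disjoint legs commute. *)
Lemma comm_leg1_r23 (a : A) (t : A ⊗ A) :
  r12 (a ⊗ (1 : A)) * r23 t = r23 t * r12 (a ⊗ (1 : A)).
Proof. by rewrite r12E /r23 !mulr_tens !mul1r !mulr1. Qed.

Lemma comm_leg3_r12 (a : A) (t : A ⊗ A) :
  r12 t * r23 ((1 : A) ⊗ a) = r23 ((1 : A) ⊗ a) * r12 t.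
Proof.
move: t; apply: tens_ext => [||x y].
- exact: linear_comp (mulr_linear (r23 ((1 : A) ⊗ a))) r12_linear.
- exact: linear_comp (mull_linear (r23 ((1 : A) ⊗ a))) r12_linear.
by rewrite r12E /r23 !mulr_tens !mul1r !mulr1.
Qed.

End Legs.

(** * The coproduct defined by [r] *)

Section Coproduct.
Variables (k : comPzRingType) (lam : k) (A : pzAlgType k).
Implicit Types (a b : A) (r s t : A ⊗ A).

Lemma tens_lmulE a t : tens_lmul a t = (a ⊗ (1 : A)) * t.
Proof.
move: t; apply: tens_ext => [||x y].
- by apply: tmap_linear; [exact: mull_linear|exact: linear_id].
- exact: mull_linear.
by rewrite /tens_lmul tmapE ?mulr_tens ?mul1r //; exact: mull_linear.
Qed.

Lemma tens_rmulE a t : tens_rmul t a = t * ((1 : A) ⊗ a).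
Proof.
move: t; apply: tens_ext => [||x y].
- by apply: tmap_linear; [exact: linear_id|exact: mulr_linear].
- exact: mulr_linear.
by rewrite /tens_rmul tmapE ?mulr_tens ?mulr1 //; exact: mulr_linear.
Qed.

Lemma Delta_ofE r a :
  Delta_of lam r a =
  (a ⊗ (1 : A)) * r - r * ((1 : A) ⊗ a) - lam *: (a ⊗ (1 : A)).
Proof. by rewrite /Delta_of tens_lmulE tens_rmulE. Qed.

Lemma Delta_of_linear r : linear (Delta_of lam r).
Proof.
move=> c a b; rewrite !Delta_ofE !tensDl !tensDr !tensZl !tensZr.
rewrite !mulrDl !mulrDr -pzscalerAl -pzscalerAr.
by rewrite !scalerBr !scalerDr !scalerA (mulrC lam) !opprD
  !(AC (2*2*2) ((1*3*5)*(2*4*6))).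
Qed.

(** The terms [a r b] and [lam *: (a ⊗ b)] of the right-hand side cancel. *)
Lemma Delta_ofM r a b : Delta_of lam r (a * b) =
  tens_lmul a (Delta_of lam r b) + tens_rmul (Delta_of lam r a) b
  + lam *: (a ⊗ b).
Proof.
rewrite tens_lmulE tens_rmulE !Delta_ofE !mulrBr !mulrBl.
rewrite -pzscalerAr -pzscalerAl -!mulrA !mulr_tens !mul1r !mulr1
  !mulrA mulr_tens mul1r.
by rewrite addrA subrK (addrAC _ (- (_ * r * _))) addrA subrK addrAC.
Qed.

(** For [t = x ⊗ y], this is [x ⊗ Delta_of lam r y]: [x] stays in the first
    leg, while [y] multiplies [r], sitting in the legs 2 and 3, on the left
    from leg 2 and on the right from leg 3. *)
Lemma tmap_id_Delta_of r t :
  tmap id (Delta_of lam r) t = r12 t * r23 r - r23 r * r13 t - lam *: r12 t.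
Proof.
move: t; apply: tens_ext => [||x y].
- by apply: tmap_linear; [exact: linear_id|exact: Delta_of_linear].
- apply: linear_sub (linear_scale _ (@r12_linear k A)).
  apply: linear_sub.
    exact: linear_comp (mulr_linear (r23 r)) (@r12_linear k A).
  exact: linear_comp (mull_linear (r23 r)) (@r13_linear k A).
rewrite tmapE //; last exact: Delta_of_linear.
rewrite Delta_ofE r12E r13E /r23 !mulr_tens mul1r mulr1.
by rewrite !(linB (@tensr_linear k A (tensor A A) x)) tensZr.
Qed.

(** Since [r12 s] is [1] in leg 3, multiplying [s] by [x] in one leg and then
    appending [y] as leg 3 amounts to multiplying [r12 s] by [x ⊗ y] placed in
    that leg and leg 3. *)
Lemma tassoc_leg1 (x y : A) s :
  tassoc (((x ⊗ (1 : A)) * s) ⊗ y) = r13 (x ⊗ y) * r12 s.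
Proof.
move: s; apply: tens_ext => [||a b].
- apply: linear_comp (@tassoc_linear k A A A) _.
  exact: linear_comp (tensl_linear y) (mull_linear (x ⊗ (1 : A))).
- exact: linear_comp (mull_linear (r13 (x ⊗ y))) (@r12_linear k A).
by rewrite mulr_tens tassocE r13E r12E !mulr_tens !mul1r mulr1.
Qed.

Lemma tassoc_leg2 (x y : A) s :
  tassoc ((s * ((1 : A) ⊗ x)) ⊗ y) = r12 s * r23 (x ⊗ y).
Proof.
move: s; apply: tens_ext => [||a b].
- apply: linear_comp (@tassoc_linear k A A A) _.
  exact: linear_comp (tensl_linear y) (mulr_linear ((1 : A) ⊗ x)).
- exact: linear_comp (mulr_linear (r23 (x ⊗ y))) (@r12_linear k A).
by rewrite mulr_tens tassocE /r23 r12E !mulr_tens mul1r mulr1.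
Qed.

Lemma tassoc_Delta_of_id r t :
  tassoc (tmap (Delta_of lam r) id t) =
  r13 t * r12 r - r12 r * r23 t - lam *: r13 t.
Proof.
have DL := Delta_of_linear r.
move: t; apply: tens_ext => [||x y].
- apply: linear_comp (@tassoc_linear k A A A) _.
  by apply: tmap_linear.
- apply: linear_sub (linear_scale _ (@r13_linear k A)).
  apply: linear_sub.
    exact: linear_comp (mulr_linear (r12 r)) (@r13_linear k A).
  exact: linear_comp (mull_linear (r12 r)) (@r23_linear k A).
rewrite tmapE // Delta_ofE !(linB (@tensl_linear k _ _ y)) tensZl.
rewrite !(linB (@tassoc_linear k A A A)) (linZ (@tassoc_linear k A A A)).
by rewrite tassoc_leg1 tassoc_leg2 tassocE r13E.
Qed.

Lemma quasitriangular_Delta_of_id r : quasitriangular lam r ->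
  tassoc (tmap (Delta_of lam r) id r) = - (r23 r * r13 r).
Proof.
by move=> rQ; rewrite tassoc_Delta_of_id -rQ opprD addrA addrN add0r.
Qed.

(** The Yang-Baxter equation enters twice, multiplied by [a1] on the left and by
    [a3] on the right; the other terms match after the two commutations. *)
Lemma quasitriangular_coassoc r :
  quasitriangular lam r -> coassociative (Delta_of lam r).
Proof.
move=> rQ a; rewrite tmap_id_Delta_of tassoc_Delta_of_id Delta_ofE.
rewrite !(linB (@r12_linear k A)) !(linB (@r13_linear k A))
  !(linB (@r23_linear k A)).
rewrite (linZ (@r12_linear k A)) (linZ (@r13_linear k A)) (linZ (@r23_linear k A)).
rewrite !r12M !r13M !r23M.
set a1 := r12 (a ⊗ (1 : A)).
have -> : r13 (a ⊗ (1 : A)) = a1 by rewrite /a1 r12E r13E.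
have -> : r23 (a ⊗ (1 : A)) = r12 ((1 : A) ⊗ a) by rewrite r12E.
have -> : r13 ((1 : A) ⊗ a) = r23 ((1 : A) ⊗ a) by rewrite r13E.
set a2 := r12 (_ ⊗ a); set a3 := r23 (_ ⊗ a).
have C1 : a1 * r23 r = r23 r * a1 := comm_leg1_r23 a r.
have C3 : r12 r * a3 = a3 * r12 r := comm_leg3_r12 a r.
rewrite !(mulrBl, mulrBr) -!pzscalerAl -!pzscalerAr !mulrA -C1.
rewrite -[r13 r * a3 * _]mulrA -C3.
have E1 : a1 * r13 r * r12 r =
    lam *: (a1 * r13 r) + a1 * r12 r * r23 r - a1 * r23 r * r13 r.
  rewrite pzscalerAr -rQ !mulrDr mulrN !mulrA.
  by rewrite [RHS]addrAC addrK subrK.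
have E3 : r23 r * r13 r * a3 =
    lam *: (r13 r * a3) + r12 r * r23 r * a3 - r13 r * r12 r * a3.
  rewrite pzscalerAl -rQ !mulrDl mulNr.
  by rewrite (addrAC _ (_ * a3) (_ * a3)) subrK addrAC addrN add0r.
rewrite E1 E3 mulrA !scalerBr !opprD !opprK !addrA.
(* In each side the first two summands in the new order are opposite: the terms
   [lam *: (a1 * r23 r)] on the left, [lam *: (a1 * r13 r)] on the right. *)
rewrite [LHS](ACl (8*3*1*2*4*5*6*7*9*10*11)).
rewrite [RHS](ACl (1*9*2*6*3*10*7*4*5*8*11)).
by rewrite /= !addrN.
Qed.

End Coproduct.

(** * The action of [A ⊗ A] on a module and the comodule structure *)

Section Comodule.
Variables (k : comPzRingType) (lam : k) (A : pzAlgType k) (M : leftModType A).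
Implicit Types (a : A) (r t : A ⊗ A) (m : M).

Let lactl_linear m : linear (fun a : A => lact a m).
Proof. exact: (@lact_bilinear k A M).1. Qed.
Let lactr_linear a : linear (fun m : M => lact a m).
Proof. exact: (@lact_bilinear k A M).2. Qed.

Lemma tens_actE (x y : A) m : tens_act (x ⊗ y) m = x ⊗ lact y m.
Proof. by rewrite /tens_act tmapE //; exact: lactl_linear. Qed.

Lemma tens_actl_linear m : linear (fun t => tens_act t m).
Proof. by apply: tmap_linear; [exact: linear_id|exact: lactl_linear]. Qed.

Lemma tens_actr_linear t : linear (fun m => tens_act t m).
Proof.
move=> c m m'; elim/tens_ind: t => [x y||s t Hs Ht].
- by rewrite !tens_actE lactr_linear tensDr tensZr.
- by rewrite !(lin0 (tens_actl_linear _)) scaler0 addr0.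
- by rewrite !(linD (tens_actl_linear _)) Hs Ht scalerDr addrACA.
Qed.

Lemma tens_lmul_linear a : linear (@tens_lmul k A M a).
Proof. by apply: tmap_linear; [exact: mull_linear|exact: linear_id]. Qed.

Lemma tens_act_lmul a t m :
  tens_act ((a ⊗ (1 : A)) * t) m = tens_lmul a (tens_act t m).
Proof.
move: t; apply: tens_ext => [||x y].
- exact: linear_comp (tens_actl_linear m) (mull_linear (a ⊗ (1 : A))).
- exact: linear_comp (tens_lmul_linear a) (tens_actl_linear m).
rewrite mulr_tens mul1r !tens_actE /tens_lmul tmapE //; exact: mull_linear.
Qed.

Lemma tens_act_rmul t a m :
  tens_act (t * ((1 : A) ⊗ a)) m = tens_act t (lact a m).
Proof.
move: t; apply: tens_ext => [||x y].
- exact: linear_comp (tens_actl_linear m) (mulr_linear ((1 : A) ⊗ a)).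
- exact: tens_actl_linear.
by rewrite mulr_tens mulr1 !tens_actE lactM.
Qed.

Definition tens3_act (w : A ⊗ (A ⊗ A)) m : A ⊗ (A ⊗ M) :=
  tmap id (fun t => tens_act t m) w.

Lemma tens3_actE (x : A) t m : tens3_act (x ⊗ t) m = x ⊗ tens_act t m.
Proof. by rewrite /tens3_act tmapE //; exact: tens_actl_linear. Qed.

Lemma tens3_act_linear m : linear (fun w => tens3_act w m).
Proof. by apply: tmap_linear; [exact: linear_id|exact: tens_actl_linear]. Qed.

(** Acting by [t] and then by [r] multiplies [m] by the second factor of [t]
    first, whence [r23 r] stands to the left of [r13 t]. *)
Lemma tmap_tens_act r t m :
  tmap id (fun m => - tens_act r m) (tens_act t m) =
  - tens3_act (r23 r * r13 t) m.
Proof.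
have L := linear_opp (tens_actr_linear r).
move: t; apply: tens_ext => [||x y].
- apply: linear_comp (tens_actl_linear m).
  by apply: tmap_linear.
- apply: linear_opp; apply: linear_comp (tens3_act_linear m) _.
  exact: linear_comp (mull_linear (r23 r)) (@r13_linear k A).
rewrite tens_actE tmapE // r13E /r23 mulr_tens mul1r tens3_actE tens_act_rmul.
by rewrite (linN (@tensr_linear k A (tensor A M) x)).
Qed.

Lemma tassoc_tens_act (w : A ⊗ A) (y : A) m :
  tassoc (w ⊗ lact y m) = tens3_act (tassoc (w ⊗ y)) m.
Proof.
move: w; apply: tens_ext => [||a b].
- exact: linear_comp (@tassoc_linear k A A M) (tensl_linear _).
- apply: linear_comp (tens3_act_linear m) _.
  exact: linear_comp (@tassoc_linear k A A A) (tensl_linear _).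
by rewrite !tassocE tens3_actE tens_actE.
Qed.

(** A map applied to the first factor ignores the action on the last one. *)
Lemma tassoc_tmap_tens_act (f : A -> A ⊗ A) t m : linear f ->
  tassoc (tmap f id (tens_act t m)) = tens3_act (tassoc (tmap f id t)) m.
Proof.
move=> fL; move: t; apply: tens_ext => [||x y].
- apply: linear_comp (@tassoc_linear k A A M) _.
  apply: linear_comp (tens_actl_linear m).
  by apply: tmap_linear.
- apply: linear_comp (tens3_act_linear m) _.
  apply: linear_comp (@tassoc_linear k A A A) _.
  by apply: tmap_linear.
by rewrite tens_actE !tmapE // tassoc_tens_act.
Qed.

Lemma tens_act_coassoc r m : quasitriangular lam r ->
  tmap id (fun m => - tens_act r m) (- tens_act r m) =
  tassoc (tmap (Delta_of lam r) id (- tens_act r m)).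
Proof.
move=> rQ; have DL := Delta_of_linear lam r.
have NL := linear_opp (tens_actr_linear r).
rewrite (linN (tmap_linear (@linear_id _ A) NL)).
rewrite (linN (tmap_linear DL (@linear_id _ M))) (linN (@tassoc_linear k A A M)).
rewrite tmap_tens_act tassoc_tmap_tens_act // quasitriangular_Delta_of_id //.
by rewrite (linN (tens3_act_linear m)).
Qed.

End Comodule.

(** * The Hopf module *)

Unset Implicit Arguments.

Theorem theorem3p9 (k : comPzRingType) (lam : k) (A : pzAlgType k)
    (r : A ⊗ A) (rQ : quasitriangular lam r)
    (n : nat) (u v : 'I_n -> A) (r_def : r = \sum_(i < n) u i ⊗ v i)
    (M : leftModType A) :
  left_inf_unitary_hopf_module lam (Delta_of lam r)
    (fun m : M => - \sum_(i < n) u i ⊗ lact (v i) m).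
Proof.
have -> : (fun m : M => - \sum_(i < n) u i ⊗ lact (v i) m) =
          (fun m => - tens_act r m).
  apply/funext => m; rewrite r_def (lin_sum (tens_actl_linear m)).
  by congr (- _); apply: eq_bigr => i _; rewrite tens_actE.
split.
- split; [exact: Delta_of_linear|exact: quasitriangular_coassoc|].
  exact: Delta_ofM.
- exact: linear_opp (tens_actr_linear r).
- by move=> m; exact: tens_act_coassoc.
move=> a m.
rewrite (linN (@tens_lmul_linear k A M a)) -tens_act_lmul -tens_act_rmul Delta_ofE.
rewrite !(linB (tens_actl_linear m)) (linZ (tens_actl_linear m)) tens_actE lact1.
by rewrite addrA subrK addrA addNr add0r.
Qed.
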